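(* Let $\mathrm{Sym}$ be a set with at least two elements. The assignment $\mathcal{C}\mapsto\mathsf{Dtry}(\mathcal{C})$ forms the action on objects of a 2-monad on the 2-category $\mathsf{Cat}$ of categories, functors and natural transformations.
   Context: $\mathrm{Sym}^*$ is the set of finite lists of elements of $\mathrm{Sym}$. A finite subset $U\subset\mathrm{Sym}^*$ is prefix-free if for all $p\neq p'$ in $U$, $p$ is not a prefix (initial segment) of $p'$. The polynomial functor $\mathrm{Dtry}\colon\mathbf{Set}\to\mathbf{Set}$ is (up to isomorphism) $\mathrm{Dtry}(X)=\sum_{U}X^U$, the sum over finite prefix-free subsets $U\subset\mathrm{Sym}^*$. Thus an element $d\in\mathrm{Dtry}(1)$ is a finite prefix-free subset of $\mathrm{Sym}^*$, and $\mathrm{Dtry}[d]$ denotes that subset itself, regarded as a finite set. For a category $\mathcal{C}$, $\mathsf{Dtry}(\mathcal{C})$ is the category in which an object is a pair $(d,X)$ with $d\in\mathrm{Dtry}(1)$ and $X\colon\mathrm{Dtry}[d]\to\mathrm{Ob}(\mathcal{C})$ a function; a morphism $(d,X)\to(d',X')$ is a pair of a function $f_0\colon\mathrm{Dtry}[d]\to\mathrm{Dtry}[d']$ and a family of morphisms $f_1(p)\colon X(p)\to X'(f_0(p))$ in $\mathcal{C}$ for $p\in\mathrm{Dtry}[d]$; the composite of $(f_0,f_1)$ followed by $(g_0,g_1)$ is $(g_0\circ f_0,\ p\mapsto g_1(f_0(p))\circ f_1(p))$, and identities are the evident ones. A 2-monad on $\mathsf{Cat}$ is a 2-functor $T\colon\mathsf{Cat}\to\mathsf{Cat}$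 with 2-natural transformations $\eta\colon 1\to T$, $\mu\colon T^2\to T$ satisfying the (strict) monad laws. *)

(* Defs.v *)
From mathcomp Require Import all_boot.
From mathcomp Require Import boolp classical_sets functions cardinality.

Set Implicit Arguments.
Unset Strict Implicit.
Unset Printing Implicit Defensive.

Declare Scope cat_scope.
Delimit Scope cat_scope with cat.
Local Open Scope cat_scope.

(* All laws below are Leibniz equalities, so that 2-functors, 2-natural
   transformations and 2-monads are strict.  Objects and morphisms live in one
   fixed universe (smallness); functor categories stay in that universe. *)

Record category := Category {
  ob :> Type;
  hom : ob -> ob -> Type;
  idm : forall x, hom x x;
  compm : forall x y z, hom y z -> hom x y -> hom x z;
  compmA : forall w x y z (h : hom y z) (g : hom x y) (f : hom w x),
    compm h (compm g f) = compm (compm h g) f;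
  comp1m : forall x y (f : hom x y), compm (idm y) f = f;
  compm1 : forall x y (f : hom x y), compm f (idm x) = f }.

Arguments hom {c} x y.
Arguments idm {c} x.
Arguments compm {c x y z} g f.

Notation "g ∘ f" := (compm g f) (at level 40, left associativity) : cat_scope.

Record functor (C D : category) := Functor {
  fob :> C -> D;
  fmap : forall x y : C, hom x y -> hom (fob x) (fob y);
  fmap1 : forall x : C, fmap (idm x) = idm (fob x);
  fmapM : forall (x y z : C) (g : hom y z) (f : hom x y),
    fmap (g ∘ f) = fmap g ∘ fmap f }.

Arguments fmap {C D} F {x y} f : rename.

Lemma functor_eq (C D : category) (F : C -> D)
    (m m' : forall x y, hom x y -> hom (F x) (F y)) m1 mM m1' mM' :
  m = m' -> @Functor C D F m m1 mM = @Functor C D F m' m1' mM'.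
Proof.
move=> e; case: _ / e m1' mM' => m1' mM'.
by rewrite (Prop_irrelevance m1 m1') (Prop_irrelevance mM mM').
Qed.

Definition fid (C : category) : functor C C :=
  @Functor C C (fun x => x) (fun _ _ f => f)
    (fun _ => erefl) (fun _ _ _ _ _ => erefl).

Section FunctorComposition.
Variables (C D E : category) (G : functor D E) (F : functor C D).

Lemma fcomp_fmap1 (x : C) : fmap G (fmap F (idm x)) = idm (G (F x)).
Proof. by rewrite !fmap1. Qed.

Lemma fcomp_fmapM (x y z : C) (g : hom y z) (f : hom x y) :
  fmap G (fmap F (g ∘ f)) = fmap G (fmap F g) ∘ fmap G (fmap F f).
Proof. by rewrite !fmapM. Qed.

Definition fcomp : functor C E :=
  @Functor C E (fun x => G (F x)) (fun _ _ f => fmap G (fmap F f))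
    fcomp_fmap1 fcomp_fmapM.

End FunctorComposition.

Notation "G ∘F F" := (fcomp G F) (at level 40, left associativity) : cat_scope.

Lemma fcompA (B C D E : category)
    (H : functor D E) (G : functor C D) (F : functor B C) :
  H ∘F (G ∘F F) = (H ∘F G) ∘F F.
Proof. exact: functor_eq. Qed.

Lemma fcomp1f (C D : category) (F : functor C D) : fid D ∘F F = F.
Proof. by case: F => *; exact: functor_eq. Qed.

Lemma fcompf1 (C D : category) (F : functor C D) : F ∘F fid C = F.
Proof. by case: F => *; exact: functor_eq. Qed.

Record nat_trans (C D : category) (F G : functor C D) := NatTrans {
  ncomp :> forall x : C, hom (F x) (G x);
  naturality : forall (x y : C) (f : hom x y),
    ncomp y ∘ fmap F f = fmap G f ∘ ncomp x }.

Lemma nat_trans_eq (C D : category) (F G : functor C D)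
    (a b : nat_trans F G) : (forall x, a x = b x) -> a = b.
Proof.
case: a b => [a na] [b nb] /= e0.
have e : a = b by exact: functional_extensionality_dep.
by case: _ / e nb => nb; rewrite (Prop_irrelevance na nb).
Qed.

Section FunctorCategory.
Variables C D : category.

Lemma nid_subproof (F : functor C D) (x y : C) (f : hom x y) :
  idm (F y) ∘ fmap F f = fmap F f ∘ idm (F x).
Proof. by rewrite comp1m compm1. Qed.

Definition nid (F : functor C D) : nat_trans F F :=
  @NatTrans _ _ F F (fun x => idm (F x)) (@nid_subproof F).

Lemma vcomp_subproof (F G H : functor C D)
    (b : nat_trans G H) (a : nat_trans F G) (x y : C) (f : hom x y) :
  (b y ∘ a y) ∘ fmap F f = fmap H f ∘ (b x ∘ a x).
Proof. by rewrite -compmA naturality compmA naturality compmA. Qed.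

Definition vcomp (F G H : functor C D)
    (b : nat_trans G H) (a : nat_trans F G) : nat_trans F H :=
  @NatTrans _ _ F H (fun x => b x ∘ a x) (vcomp_subproof b a).

Lemma vcompA (F G H K : functor C D) (c : nat_trans H K)
    (b : nat_trans G H) (a : nat_trans F G) :
  vcomp c (vcomp b a) = vcomp (vcomp c b) a.
Proof. by apply: nat_trans_eq => x /=; exact: compmA. Qed.

Lemma vcomp1n (F G : functor C D) (a : nat_trans F G) : vcomp (nid G) a = a.
Proof. by apply: nat_trans_eq => x /=; exact: comp1m. Qed.

Lemma vcompn1 (F G : functor C D) (a : nat_trans F G) : vcomp a (nid F) = a.
Proof. by apply: nat_trans_eq => x /=; exact: compm1. Qed.

Definition functor_cat : category :=
  @Category (functor C D) (@nat_trans C D) nid vcomp vcompA vcomp1n vcompn1.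

End FunctorCategory.

Notation "[ C ~> D ]" := (functor_cat C D)
  (at level 0, C at level 99, D at level 99) : cat_scope.

Section ProductCategory.
Variables C D : category.

Let phom (u v : C * D) : Type := (hom u.1 v.1 * hom u.2 v.2)%type.
Let pid (u : C * D) : phom u u := (idm u.1, idm u.2).
Let pcomp (u v w : C * D) (g : phom v w) (f : phom u v) : phom u w :=
  (g.1 ∘ f.1, g.2 ∘ f.2).

Lemma pcompA (t u v w : C * D) (h : phom v w) (g : phom u v) (f : phom t u) :
  pcomp h (pcomp g f) = pcomp (pcomp h g) f.
Proof. by rewrite /pcomp /= !compmA. Qed.

Lemma pcomp1m (u v : C * D) (f : phom u v) : pcomp (pid v) f = f.
Proof. by case: f => f1 f2; rewrite /pcomp /= !comp1m. Qed.

Lemma pcompm1 (u v : C * D) (f : phom u v) : pcomp f (pid u) = f.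
Proof. by case: f => f1 f2; rewrite /pcomp /= !compm1. Qed.

Definition prod_cat : category :=
  @Category (C * D)%type phom pid pcomp pcompA pcomp1m pcompm1.

End ProductCategory.

Section ProductFunctor.
Variables (C C' D D' : category) (F : functor C C') (G : functor D D').

Let pob (u : prod_cat C D) : prod_cat C' D' := (F u.1, G u.2).
Let pmap (u v : prod_cat C D) (f : hom u v) : hom (pob u) (pob v) :=
  (fmap F f.1, fmap G f.2).

Lemma prod_fmap1 (u : prod_cat C D) : pmap (idm u) = idm (pob u).
Proof. by rewrite /pmap /= !fmap1. Qed.

Lemma prod_fmapM (u v w : prod_cat C D) (g : hom v w) (f : hom u v) :
  pmap (g ∘ f) = pmap g ∘ pmap f.
Proof. by rewrite /pmap /= !fmapM. Qed.

Definition prod_functor : functor (prod_cat C D) (prod_cat C' D') :=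
  @Functor _ _ pob pmap prod_fmap1 prod_fmapM.

End ProductFunctor.

Section HorizontalComposition.
Variables C D E : category.

Lemma hcomp2_subproof (G G' : functor D E) (F F' : functor C D)
    (b : nat_trans G G') (a : nat_trans F F') (x y : C) (f : hom x y) :
  (b (F' y) ∘ fmap G (a y)) ∘ fmap (G ∘F F) f =
  fmap (G' ∘F F') f ∘ (b (F' x) ∘ fmap G (a x)).
Proof.
rewrite /= -compmA -(fmapM G) (naturality a) (fmapM G) compmA (naturality b).
by rewrite -compmA.
Qed.

Definition hcomp2 (G G' : functor D E) (F F' : functor C D)
    (b : nat_trans G G') (a : nat_trans F F') :
    nat_trans (G ∘F F) (G' ∘F F') :=
  @NatTrans _ _ (G ∘F F) (G' ∘F F')
    (fun x => b (F' x) ∘ fmap G (a x)) (hcomp2_subproof b a).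

Let hob (u : prod_cat [D ~> E] [C ~> D]) : [C ~> E] := u.1 ∘F u.2.
Let hmap (u v : prod_cat [D ~> E] [C ~> D]) (f : hom u v) :
  hom (hob u) (hob v) := hcomp2 f.1 f.2.

Lemma hcomp_fmap1 u : hmap (idm u) = idm (hob u).
Proof. by apply: nat_trans_eq => x /=; rewrite fmap1 comp1m. Qed.

Lemma hcomp_fmapM u v w (g : hom v w) (f : hom u v) :
  hmap (g ∘ f) = hmap g ∘ hmap f.
Proof.
apply: nat_trans_eq => x /=.
rewrite fmapM !compmA; congr (_ ∘ _).
by rewrite -!compmA; congr (_ ∘ _); rewrite naturality.
Qed.

Definition hcomp : functor (prod_cat [D ~> E] [C ~> D]) [C ~> E] :=
  @Functor _ _ hob hmap hcomp_fmap1 hcomp_fmapM.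

End HorizontalComposition.

Section Whiskering.
Variables B C D : category.

Lemma postwhisker_subproof (H : functor C D) (F G : functor B C)
    (a : nat_trans F G) (x y : B) (f : hom x y) :
  fmap H (a y) ∘ fmap (H ∘F F) f = fmap (H ∘F G) f ∘ fmap H (a x).
Proof. by rewrite /= -!fmapM naturality. Qed.

Definition postwhisker2 (H : functor C D) (F G : functor B C)
    (a : nat_trans F G) : nat_trans (H ∘F F) (H ∘F G) :=
  @NatTrans _ _ (H ∘F F) (H ∘F G)
    (fun x => fmap H (a x)) (postwhisker_subproof H a).

Lemma postwhisker_fmap1 (H : functor C D) (F : [B ~> C]) :
  postwhisker2 H (idm F) = nid (H ∘F F).
Proof. by apply: nat_trans_eq => x /=; rewrite fmap1. Qed.

Lemma postwhisker_fmapM (H : functor C D) (F G K : [B ~> C])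
    (b : hom G K) (a : hom F G) :
  postwhisker2 H (b ∘ a) =
  vcomp (postwhisker2 H b) (postwhisker2 H a).
Proof. by apply: nat_trans_eq => x /=; rewrite fmapM. Qed.

Definition postwhisker (H : functor C D) : functor [B ~> C] [B ~> D] :=
  @Functor [B ~> C] [B ~> D] (fun F => H ∘F F)
    (fun _ _ a => postwhisker2 H a)
    (postwhisker_fmap1 H) (@postwhisker_fmapM H).

Lemma prewhisker_subproof (H : functor B C) (F G : functor C D)
    (a : nat_trans F G) (x y : B) (f : hom x y) :
  a (H y) ∘ fmap (F ∘F H) f = fmap (G ∘F H) f ∘ a (H x).
Proof. by rewrite /= naturality. Qed.

Definition prewhisker2 (H : functor B C) (F G : functor C D)
    (a : nat_trans F G) : nat_trans (F ∘F H) (G ∘F H) :=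
  @NatTrans _ _ (F ∘F H) (G ∘F H)
    (fun x => a (H x)) (prewhisker_subproof H a).

Lemma prewhisker_fmap1 (H : functor B C) (F : [C ~> D]) :
  prewhisker2 H (idm F) = nid (F ∘F H).
Proof. exact: nat_trans_eq. Qed.

Lemma prewhisker_fmapM (H : functor B C) (F G K : [C ~> D])
    (b : hom G K) (a : hom F G) :
  prewhisker2 H (b ∘ a) =
  vcomp (prewhisker2 H b) (prewhisker2 H a).
Proof. exact: nat_trans_eq. Qed.

Definition prewhisker (H : functor B C) : functor [C ~> D] [B ~> D] :=
  @Functor [C ~> D] [B ~> D] (fun F => F ∘F H)
    (fun _ _ a => prewhisker2 H a)
    (prewhisker_fmap1 H) (@prewhisker_fmapM H).

End Whiskering.

(* A 2-functor Cat -> Cat, as a Cat-enriched functor: its action on 1-cells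
   and 2-cells is a family of functors between hom-categories (functoriality
   being preservation of vertical composition), and [tfunM], an equality of
   functors, is preservation of composition of 1-cells and of horizontal
   composition of 2-cells. *)
Record two_functor := TwoFunctor {
  tob :> category -> category;
  tfun : forall C D : category, functor [C ~> D] [tob C ~> tob D];
  tfun1 : forall C : category, tfun C C (fid C) = fid (tob C);
  tfunM : forall C D E : category,
    tfun C E ∘F hcomp C D E =
    hcomp (tob C) (tob D) (tob E) ∘F prod_functor (tfun D E) (tfun C D) }.

Arguments tfun T {C D} : rename.

Lemma tfid_subproof (C D E : category) :
  fid [C ~> E] ∘F hcomp C D E =
  hcomp C D E ∘F prod_functor (fid [D ~> E]) (fid [C ~> D]).
Proof. exact: functor_eq. Qed.

Definition tfid : two_functor :=
  @TwoFunctor (fun C => C) (fun C D => fid [C ~> D]) (fun _ => erefl)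
    tfid_subproof.

Section TwoFunctorComposition.
Variables S T : two_functor.

Lemma tcomp1 (C : category) :
  (tfun S ∘F tfun T) (fid C) = fid (S (T C)).
Proof. by rewrite /= !tfun1. Qed.

Lemma tcompM (C D E : category) :
  (tfun S ∘F tfun T) ∘F hcomp C D E =
  hcomp (S (T C)) (S (T D)) (S (T E)) ∘F
    prod_functor (tfun S ∘F tfun T) (tfun S ∘F tfun T).
Proof.
rewrite -fcompA tfunM fcompA tfunM -fcompA; congr (_ ∘F _).
exact: functor_eq.
Qed.

Definition tcomp : two_functor :=
  @TwoFunctor (fun C => S (T C)) (fun _ _ => tfun S ∘F tfun T) tcomp1 tcompM.

End TwoFunctorComposition.

(* The equality of functors [C ~> D] -> [S C ~> T D] expresses naturality both
   with respect to 1-cells (on objects) and 2-cells (on morphisms). *)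
Record two_nat_trans (S T : two_functor) := TwoNatTrans {
  tcomponent :> forall C : category, functor (S C) (T C);
  two_naturality : forall C D : category,
    postwhisker (S C) (tcomponent D) ∘F tfun S =
    prewhisker (T D) (tcomponent C) ∘F @tfun T C D }.

Record two_monad := TwoMonad {
  tm_functor :> two_functor;
  tm_unit : two_nat_trans tfid tm_functor;
  tm_mult : two_nat_trans (tcomp tm_functor tm_functor) tm_functor;
  tm_assoc : forall C : category,
    tm_mult C ∘F tfun tm_functor (tm_mult C) =
    tm_mult C ∘F tm_mult (tm_functor C);
  tm_unitl : forall C : category,
    tm_mult C ∘F tm_unit (tm_functor C) = fid (tm_functor C);
  tm_unitr : forall C : category,
    tm_mult C ∘F tfun tm_functor (tm_unit C) = fid (tm_functor C) }.

Definition prefix_free (Sym : Type) (U : set (seq Sym)) : Prop :=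
  forall p p' : seq Sym, U p -> U p' -> p <> p' ->
    ~ exists s : seq Sym, p' = p ++ s.

Record dtry1 (Sym : Type) := Dtry1 {
  paths :> set (seq Sym);
  paths_finite : finite_set paths;
  paths_prefix_free : prefix_free paths }.

Section DtryCategory.
Variables (Sym : Type) (C : category).

(* In [shape -> C], [shape] is coerced first to the set of its paths, then to
   the corresponding subtype of [seq Sym]. *)
Record dtry_ob := DtryOb {
  shape : dtry1 Sym;
  leaf : shape -> C }.

Record dtry_hom (X Y : dtry_ob) := DtryHom {
  dir_map : shape X -> shape Y;
  leaf_map : forall p : shape X, hom (leaf p) (leaf (dir_map p)) }.

Definition dtry_id (X : dtry_ob) : dtry_hom X X :=
  @DtryHom X X (fun p => p) (fun p => idm (leaf p)).

Definition dtry_comp (X Y Z : dtry_ob)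
    (g : dtry_hom Y Z) (f : dtry_hom X Y) : dtry_hom X Z :=
  @DtryHom X Z (fun p => dir_map g (dir_map f p))
    (fun p => leaf_map g (dir_map f p) ∘ leaf_map f p).

Lemma dtry_compA (W X Y Z : dtry_ob)
    (h : dtry_hom Y Z) (g : dtry_hom X Y) (f : dtry_hom W X) :
  dtry_comp h (dtry_comp g f) = dtry_comp (dtry_comp h g) f.
Proof.
rewrite /dtry_comp /=; congr DtryHom.
by apply: functional_extensionality_dep => p; exact: compmA.
Qed.

Lemma dtry_comp1m (X Y : dtry_ob) (f : dtry_hom X Y) :
  dtry_comp (dtry_id Y) f = f.
Proof.
case: f => f0 f1; rewrite /dtry_comp /=; congr DtryHom.
by apply: functional_extensionality_dep => p; exact: comp1m.
Qed.

Lemma dtry_compm1 (X Y : dtry_ob) (f : dtry_hom X Y) :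
  dtry_comp f (dtry_id X) = f.
Proof.
case: f => f0 f1; rewrite /dtry_comp /=; congr DtryHom.
by apply: functional_extensionality_dep => p; exact: compm1.
Qed.

Definition dtry_cat : category :=
  @Category dtry_ob dtry_hom dtry_id dtry_comp
    dtry_compA dtry_comp1m dtry_compm1.

End DtryCategory.

(* Main.v *)
From mathcomp Require Import all_boot.
From mathcomp Require Import boolp classical_sets cardinality.
Require Import Defs.

(** The unit sends [x] to the one-leaf tree [{[::]}], and the multiplication
    grafts trees by concatenating paths: a path of the grafted tree is [p ++ q]
    with [p] a path of the outer tree and [q] a path of the tree at the leaf [p].
    Prefix-freeness makes the decomposition unique, so leaves and maps of the
    grafted tree are determined by their values on concatenations, and the
    monad laws reduce to the monoid laws for [++].  Since a path of a grafted
    tree remembers its decomposition only propositionally, the strict equalities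
    of functors are proved through heterogeneous equality of morphisms. *)

Set Implicit Arguments.
Unset Strict Implicit.
Unset Printing Implicit Defensive.

Local Open Scope cat_scope.

(** * Heterogeneous equality of morphisms *)

Definition cast_hom (C : category) (x y x' y' : C) (ex : x = x') (ey : y = y')
    (f : hom x y) : hom x' y' :=
  let: erefl := ex in let: erefl := ey in f.

(** The endpoint equalities are part of the relation, so [heq] between the values of two functors
    also carries the equality of their object maps. *)
Definition heq (C : category) (x y x' y' : C)
    (f : hom x y) (f' : hom x' y') : Prop :=
  exists (ex : x = x') (ey : y = y'), cast_hom ex ey f = f'.

Lemma heq_refl (C : category) (x y : C) (f : hom x y) : heq f f.
Proof. by exists erefl, erefl. Qed.

Section HeterogeneousEquality.
Variable C : category.
Implicit Types x y z : C.

Lemma heq_sym x y x' y' (f : hom x y) (f' : hom x' y') : heq f f' -> heq f' f.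
Proof. by case=> ex [ey <-]; case: _ / ex; case: _ / ey; exact: heq_refl. Qed.

Lemma heq_trans x y x' y' x'' y''
    (f : hom x y) (f' : hom x' y') (f'' : hom x'' y'') :
  heq f f' -> heq f' f'' -> heq f f''.
Proof.
by case=> ex [ey <-]; case: _ / ex; case: _ / ey.
Qed.

Lemma heq_eq x y (f f' : hom x y) : heq f f' -> f = f'.
Proof.
case=> ex [ey <-].
by rewrite (Prop_irrelevance ex erefl) (Prop_irrelevance ey erefl).
Qed.

Lemma cast_hom_heq x y x' y' (ex : x = x') (ey : y = y') (f : hom x y) :
  heq (cast_hom ex ey f) f.
Proof. by apply: heq_sym; exists ex, ey. Qed.

Lemma heq_idm x x' : x = x' -> heq (idm x) (idm x').
Proof. by move=> <-; exact: heq_refl. Qed.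

Lemma heq_comp x y z x' y' z' (g : hom y z) (f : hom x y)
    (g' : hom y' z') (f' : hom x' y') :
  heq g g' -> heq f f' -> heq (g ∘ f) (g' ∘ f').
Proof.
case=> ey [ez <-]; case=> ex [ey' <-].
case: _ / ex; case: _ / ez; case: _ / ey ey' => ey'.
(* Both hypotheses identify the middle objects; proof irrelevance merges the two identifications. *)
by rewrite (Prop_irrelevance ey' erefl); exact: heq_refl.
Qed.

Lemma heq_fmap (D : category) (F : functor C D) x y x' y'
    (f : hom x y) (f' : hom x' y') :
  heq f f' -> heq (fmap F f) (fmap F f').
Proof. by case=> ex [ey <-]; case: _ / ex; case: _ / ey; exact: heq_refl. Qed.

Lemma heq_ncomp (D : category) (F G : functor C D) (a : nat_trans F G) x x' :
  x = x' -> heq (a x) (a x').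
Proof. by move=> <-; exact: heq_refl. Qed.

End HeterogeneousEquality.

(** * Extensionality for functors, transformations, trees and tree maps *)

Lemma functor_ext (C D : category) (F G : functor C D) :
  (forall (x y : C) (f : hom x y), heq (fmap F f) (fmap G f)) -> F = G.
Proof.
case: F G => [F0 F1 F1i FM] [G0 G1 G1i GM] /= h.
(* The endpoints of [h] at identities give the equality on objects. *)
have e0 : F0 = G0 by apply: funext => x; case: (h x x (idm x)).
case: _ / e0 G1 G1i GM h => G1 G1i GM h; apply: functor_eq.
apply: functional_extensionality_dep => x.
apply: functional_extensionality_dep => y.
apply: functional_extensionality_dep => f.
exact/heq_eq/h.
Qed.

Lemma nat_trans_heq (C D : category) (F G F' G' : [C ~> D])
    (a : nat_trans F G) (a' : nat_trans F' G') :
  F = F' -> G = G' -> (forall x, heq (a x) (a' x)) ->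
  @heq [C ~> D] F G F' G' a a'.
Proof.
move=> eF eG; case: _ / eF a' => a'; case: _ / eG a' => a' h.
have -> : a = a' by apply: nat_trans_eq => x; exact/heq_eq/h.
exact: heq_refl.
Qed.

Section DtryExtensionality.
Variables (Sym : Type) (C : category).

Lemma dtry1_eq (d d' : dtry1 Sym) :
  (forall p, paths d p <-> paths d' p) -> d = d'.
Proof.
case: d d' => [U fU pU] [U' fU' pU'] /= h.
have e : U = U' by apply: funext => p; apply: propext.
case: _ / e fU' pU' {h} => fU' pU'.
by rewrite (Prop_irrelevance fU fU') (Prop_irrelevance pU pU').
Qed.

(** Leaves are compared at paths with the same underlying word, which avoids transport along the
    equality of shapes. *)
Lemma dtry_ob_eq (X Y : dtry_ob Sym C) :
  (forall p, paths (shape X) p <-> paths (shape Y) p) ->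
  (forall (p : shape X) (q : shape Y), val p = val q -> leaf p = leaf q) ->
  X = Y.
Proof.
case: X Y => [d X] [d' Y] /= hd hl.
have e := dtry1_eq hd; case: _ / e Y hl {hd} => Y hl.
by congr DtryOb; apply: funext => p; exact: hl.
Qed.

Lemma dtry_hom_heq (X Y X' Y' : dtry_cat Sym C)
    (f : dtry_hom X Y) (f' : dtry_hom X' Y') :
  X = X' -> Y = Y' ->
  (forall (p : shape X) (p' : shape X'), val p = val p' ->
     val (dir_map f p) = val (dir_map f' p') /\
     heq (leaf_map f p) (leaf_map f' p')) ->
  @heq (dtry_cat Sym C) X Y X' Y' f f'.
Proof.
move=> eX eY; case: _ / eX f' => f'; case: _ / eY f' => f' h.
suff -> : f = f' by exact: heq_refl.
case: f f' h => [f0 f1] [g0 g1] /= h.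
have e0 : f0 = g0.
  by apply: funext => p; apply: val_inj; case: (h p p erefl).
case: _ / e0 g1 h => g1 h; congr DtryHom.
apply: functional_extensionality_dep => p; apply: heq_eq.
by case: (h p p erefl).
Qed.

(** Converse of [dtry_hom_heq], used to read off values from an equality of tree maps. *)
Lemma heq_dtry_hom (X Y X' Y' : dtry_cat Sym C)
    (f : dtry_hom X Y) (f' : dtry_hom X' Y') (p : shape X) (p' : shape X') :
  @heq (dtry_cat Sym C) X Y X' Y' f f' -> val p = val p' ->
  val (dir_map f p) = val (dir_map f' p') /\
  heq (leaf_map f p) (leaf_map f' p').
Proof.
case=> eX [eY <-]; case: _ / eX p' => p'; case: _ / eY => /val_inj <-.
by split=> //; exact: heq_refl.
Qed.

Lemma dtry_ob_path (X Y : dtry_ob Sym C) (p : shape X) :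
  X = Y -> exists2 q : shape Y, val p = val q & leaf p = leaf q.
Proof. by move=> <-; exists p. Qed.

End DtryExtensionality.

(** * The 2-functor: relabelling of leaves *)

Section DtryTwoFunctor.
Variable Sym : Type.
Local Notation T := (dtry_cat Sym).

Section OneCell.
Variables (C D : category) (F : functor C D).

Definition dtry_fob (X : T C) : T D :=
  @DtryOb Sym D (shape X) (fun p => F (leaf p)).

Definition dtry_fmap (X Y : T C) (f : hom X Y) :
    hom (dtry_fob X) (dtry_fob Y) :=
  @DtryHom Sym D (dtry_fob X) (dtry_fob Y) (dir_map f)
    (fun p => fmap F (leaf_map f p)).

Lemma dtry_fmap1 (X : T C) : dtry_fmap (idm X) = idm (dtry_fob X).
Proof.
rewrite /dtry_fmap /= /dtry_id; congr DtryHom.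
by apply: functional_extensionality_dep => p /=; rewrite fmap1.
Qed.

Lemma dtry_fmapM (X Y Z : T C) (g : hom Y Z) (f : hom X Y) :
  dtry_fmap (g ∘ f) = dtry_fmap g ∘ dtry_fmap f.
Proof.
rewrite /dtry_fmap /= /dtry_comp; congr DtryHom.
by apply: functional_extensionality_dep => p /=; rewrite fmapM.
Qed.

Definition dtry_functor : functor (T C) (T D) := Functor dtry_fmap1 dtry_fmapM.

End OneCell.

Section TwoCell.
Variables (C D : category) (F G : functor C D) (a : nat_trans F G).

Definition dtry_ncomp (X : T C) : hom (dtry_functor F X) (dtry_functor G X) :=
  @DtryHom Sym D (dtry_fob F X) (dtry_fob G X) id
    (fun p : shape X => a (leaf p)).

Lemma dtry_naturality (X Y : T C) (f : hom X Y) :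
  dtry_ncomp Y ∘ fmap (dtry_functor F) f =
  fmap (dtry_functor G) f ∘ dtry_ncomp X.
Proof.
rewrite /= /dtry_comp; congr DtryHom.
by apply: functional_extensionality_dep => p /=; rewrite naturality.
Qed.

Definition dtry_nat : nat_trans (dtry_functor F) (dtry_functor G) :=
  NatTrans dtry_naturality.

End TwoCell.

Section HomFunctor.
Variables C D : category.

Lemma dtry_nat1 (F : [C ~> D]) : dtry_nat (idm F) = nid (dtry_functor F).
Proof. exact: nat_trans_eq. Qed.

Lemma dtry_natM (F G H : [C ~> D]) (b : hom G H) (a : hom F G) :
  dtry_nat (b ∘ a) = vcomp (dtry_nat b) (dtry_nat a).
Proof. exact: nat_trans_eq. Qed.

Definition dtry_tfun : functor [C ~> D] [T C ~> T D] :=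
  @Functor [C ~> D] [T C ~> T D] (@dtry_functor C D) (@dtry_nat C D)
    dtry_nat1 dtry_natM.

End HomFunctor.

(** Eta for [dtry_ob] is not definitional, so the identity functor is preserved only propositionally
    on objects. *)
Lemma dtry_obK (C : category) (X : T C) :
  @DtryOb Sym C (shape X) (fun p => leaf p) = X.
Proof. by case: X. Qed.

Lemma dtry_tfun1 (C : category) : dtry_tfun C C (fid C) = fid (T C).
Proof.
apply: functor_ext => X Y f; apply: dtry_hom_heq; try exact: dtry_obK.
by move=> p p' /val_inj <- /=; split=> //; exact: heq_refl.
Qed.

Lemma dtry_tfunM (C D E : category) :
  dtry_tfun C E ∘F hcomp C D E =
  hcomp (T C) (T D) (T E) ∘F prod_functor (dtry_tfun D E) (dtry_tfun C D).
Proof.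
(* The case of 1-cells comes first: it supplies the endpoint equalities needed to compare
   2-cells. *)
have e (G : functor D E) (F : functor C D) :
    dtry_functor (G ∘F F) = dtry_functor G ∘F dtry_functor F.
  by apply: functor_ext => X Y f; exact: heq_refl.
apply: functor_ext => -[G F] [G' F'] [b a].
apply: nat_trans_heq; try exact: e.
by move=> X /=; apply: heq_refl.
Qed.

Definition dtry_two_functor : two_functor :=
  @TwoFunctor T dtry_tfun dtry_tfun1 dtry_tfunM.

End DtryTwoFunctor.

(** * The unit: one-leaf trees *)

Section Unit.
Variables (Sym : Type) (C : category).
Local Notation T := (dtry_cat Sym).

Lemma dtry_root_prefix_free : prefix_free [set ([::] : seq Sym)]%classic.
Proof. by move=> p p' -> ->. Qed.

Definition dtry_root : dtry1 Sym :=
  Dtry1 (finite_set1 [::]) dtry_root_prefix_free.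

Definition dtry_eta_ob (x : C) : T C := @DtryOb Sym C dtry_root (fun _ => x).

Definition dtry_eta_map (x y : C) (f : hom x y) :
    hom (dtry_eta_ob x) (dtry_eta_ob y) :=
  @DtryHom Sym C (dtry_eta_ob x) (dtry_eta_ob y) id (fun _ => f).

Lemma dtry_eta_map1 (x : C) : dtry_eta_map (idm x) = idm (dtry_eta_ob x).
Proof. by []. Qed.

Lemma dtry_eta_mapM (x y z : C) (g : hom y z) (f : hom x y) :
  dtry_eta_map (g ∘ f) = dtry_eta_map g ∘ dtry_eta_map f.
Proof. by []. Qed.

Definition dtry_eta : functor C (T C) := Functor dtry_eta_map1 dtry_eta_mapM.

Lemma val_root (x : C) (p : shape (dtry_eta_ob x)) : val p = [::].
Proof. exact: (set_valP p). Qed.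

Definition root_path (x : C) : shape (dtry_eta_ob x) :=
  exist _ [::] (mem_set (erefl : [set ([::] : seq Sym)]%classic [::])).

End Unit.

(** * Unique decomposition of concatenated paths *)

Lemma cat_eq_prefix (A : Type) (s t s' t' : seq A) :
  s ++ t = s' ++ t' -> (exists u, s' = s ++ u) \/ (exists u, s = s' ++ u).
Proof.
elim: s s' => [|a s IH] [|a' s'] /=.
- by left; exists [::].
- by left; exists (a' :: s').
- by right; exists (a :: s).
by case=> -> /IH [[u ->]|[u ->]]; [left|right]; exists u.
Qed.

Lemma catl_inj (A : Type) (s t t' : seq A) : s ++ t = s ++ t' -> t = t'.
Proof. by move/(congr1 (drop (size s))); rewrite !drop_size_cat. Qed.

(** Both paths are initial segments of one word, hence comparable, and a prefix-free set has no two
    distinct comparable elements. *)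
Lemma prefix_free_cat (Sym : Type) (d : dtry1 Sym) (p p' : d) t t' :
  val p ++ t = val p' ++ t' -> p = p'.
Proof.
move=> e; apply: val_inj; apply: contrapT => ne.
have dp := set_valP p; have dp' := set_valP p'.
case: (cat_eq_prefix e) => h; first exact: paths_prefix_free dp dp' ne h.
by apply: paths_prefix_free dp' dp _ h => /esym.
Qed.

(** * The multiplication: grafting of trees *)

Section Multiplication.
Variables (Sym : Type) (C : category).
Local Notation T := (dtry_cat Sym).

Section Object.
Variable X : T (T C).

Definition path_pair := {p : shape X & shape (leaf p)}.
Definition path_mk (p : shape X) (q : shape (leaf p)) : path_pair :=
  Tagged (fun p : shape X => shape (leaf p)) q.

Definition path_cat (u : path_pair) : seq Sym := val (tag u) ++ val (tagged u).

(** Prefix-freeness of the outer tree identifies the first components; left cancellation then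
    identifies the second ones. *)
Lemma path_cat_inj : injective path_cat.
Proof.
move=> [p q] [p' q']; rewrite /path_cat /= => e.
have ep := prefix_free_cat e; case: _ / ep q' e => q' /catl_inj/val_inj.
by move=> ->.
Qed.

Definition mu_paths : set (seq Sym) := range path_cat.

Lemma mu_paths_finite : finite_set mu_paths.
Proof.
(* A union, over the finitely many outer paths, of translates of finite sets. *)
have -> : mu_paths = (\bigcup_(p in [set: shape X])
    (cat (val p) @` paths (shape (leaf p))))%classic.
  apply/seteqP; split=> w /=.
    by case=> -[p q] _ <-; exists p => //; exists (val q) => //; exact: set_valP.
  case=> p _ [s ds <-].
  by exists (@path_mk p (exist _ s (mem_set ds))).
apply: bigcup_finite => [|p _]; last exact/finite_image/paths_finite.
(* Finiteness of the type of outer paths comes from the set of words through the injection [val]. *)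
have -> : [set: shape X]%classic = (val @^-1` paths (shape X))%classic.
  by apply/seteqP; split=> p //= _; exact: set_valP.
apply: finite_preimage; last exact: paths_finite.
by move=> p q _ _ /val_inj.
Qed.

(** If [p ++ q] is a prefix of [p' ++ q'], then [p = p'] by the outer tree, so [q] is a prefix of
    [q'] inside a single inner tree. *)
Lemma mu_paths_prefix_free : prefix_free mu_paths.
Proof.
move=> _ _ [[p q] _ <-] [[p' q'] _ <-]; rewrite /path_cat /= => ne [s].
rewrite -catA => e; have ep := esym (prefix_free_cat e).
case: _ / ep q' e ne => q' /catl_inj e ne.
apply: (paths_prefix_free (set_valP q) (set_valP q')); last by exists s.
by move=> eq; apply: ne; exact: congr1 eq.
Qed.

Definition mu_shape : dtry1 Sym := Dtry1 mu_paths_finite mu_paths_prefix_free.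

Definition path_join (u : path_pair) : mu_shape :=
  exist _ (path_cat u)
    (mem_set (ex_intro2 _ _ u I erefl : mu_paths (path_cat u))).

Lemma path_splitP (r : mu_shape) : exists u, path_cat u = val r.
Proof. by case: (set_valP r) => u _ e; exists u. Qed.

(** Membership in [mu_paths] only asserts existence, hence the choice by [cid]; [path_cat_inj] makes
    the result unique. *)
Definition path_split (r : mu_shape) : path_pair := sval (cid (path_splitP r)).

Lemma path_splitK (r : mu_shape) : path_cat (path_split r) = val r.
Proof. by rewrite /path_split; case: cid. Qed.

Lemma path_splitE (r : mu_shape) (u : path_pair) :
  val r = path_cat u -> path_split r = u.
Proof. by move=> e; apply: path_cat_inj; rewrite path_splitK. Qed.

Definition mu_ob : T C :=
  @DtryOb Sym C mu_shape (fun r => leaf (tagged (path_split r))).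

Lemma mu_cases (r : shape mu_ob) :
  exists p : shape X, exists q : shape (leaf p), val r = val p ++ val q.
Proof. by case: (path_splitP r) => -[p q] /= <-; exists p, q. Qed.

(** Uniqueness of the decomposition allows any splitting of [r] in place of the chosen one. *)
Lemma mu_leaf (r : shape mu_ob) (p : shape X) (q : shape (leaf p)) :
  val r = val p ++ val q -> leaf r = leaf q.
Proof. by move=> e; rewrite /= (path_splitE (u := path_mk q) e). Qed.

Lemma mu_pathsP (w : seq Sym) : paths (shape mu_ob) w <->
  exists p : shape X, exists q : shape (leaf p), w = val p ++ val q.
Proof.
split=> [[[p q] _ <-]|[p [q ->]]]; first by exists p, q.
by exists (path_mk q).
Qed.

End Object.

Section Morphism.
Variables (X Y : T (T C)) (f : hom X Y).

Definition mu_dir (u : path_pair X) : path_pair Y :=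
  path_mk (dir_map (leaf_map f (tag u)) (tagged u)).

(* The cast is along the propositional identification of the leaf at a
   concatenated path with the leaf at its second component. *)
Definition mu_map : hom (mu_ob X) (mu_ob Y) :=
  @DtryHom Sym C (mu_ob X) (mu_ob Y)
    (fun r => path_join (mu_dir (path_split r)))
    (fun r => cast_hom erefl
      (esym (@mu_leaf Y (path_join (mu_dir (path_split r))) _ _ erefl))
      (leaf_map (leaf_map f (tag (path_split r))) (tagged (path_split r)))).

Lemma mu_mapE (r : shape (mu_ob X)) (p : shape X) (q : shape (leaf p)) :
  val r = val p ++ val q ->
  val (dir_map mu_map r) =
    val (dir_map f p) ++ val (dir_map (leaf_map f p) q) /\
  heq (leaf_map mu_map r) (leaf_map (leaf_map f p) q).
Proof.
move=> e.
(* Since the type of [q] depends on [p], the claim is abstracted over the whole pair, so that it can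
   be replaced by [path_split r], where only the cast remains. *)
pose P (u : path_pair X) := val (dir_map mu_map r) =
    val (dir_map f (tag u)) ++ val (dir_map (leaf_map f (tag u)) (tagged u)) /\
  heq (leaf_map mu_map r) (leaf_map (leaf_map f (tag u)) (tagged u)).
suff : P (path_mk q) by [].
rewrite -(path_splitE (u := path_mk q) e).
by split=> //; exact: cast_hom_heq.
Qed.

End Morphism.

Lemma mu_map1 (X : T (T C)) : mu_map (idm X) = idm (mu_ob X).
Proof.
apply: heq_eq; apply: dtry_hom_heq => // r r' /val_inj <-.
have [p [q e]] := mu_cases r; have [e0 e1] := mu_mapE (idm X) e.
split; first by rewrite e0 e.
exact: heq_trans e1 (heq_idm (esym (mu_leaf e))).
Qed.

Lemma mu_mapM (X Y Z : T (T C)) (g : hom Y Z) (f : hom X Y) :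
  mu_map (g ∘ f) = mu_map g ∘ mu_map f.
Proof.
apply: heq_eq; apply: dtry_hom_heq => // r r' /val_inj <-.
have [p [q e]] := mu_cases r; have [f0 f1] := mu_mapE f e.
(* [f0] is a decomposition of the image of [r], as required to evaluate [mu_map g] there. *)
have [g0 g1] := mu_mapE g f0; have [h0 h1] := mu_mapE (g ∘ f) e.
split; first by rewrite h0 g0.
by apply: heq_trans h1 _; apply: heq_sym; apply: heq_comp.
Qed.

Definition dtry_mu : functor (T (T C)) (T C) := Functor mu_map1 mu_mapM.

End Multiplication.

(** * 2-naturality of unit and multiplication *)

Section Monad.
Variable Sym : Type.
Local Notation T := (dtry_two_functor Sym).

Lemma dtry_eta_natural (C D : category) :
  postwhisker (tfid C) (dtry_eta Sym D) ∘F @tfun tfid C D =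
  prewhisker (T D) (dtry_eta Sym C) ∘F @tfun T C D.
Proof.
have e (F : functor C D) :
    dtry_eta Sym D ∘F F = dtry_functor Sym F ∘F dtry_eta Sym C.
  by apply: functor_ext => x y f; exact: heq_refl.
apply: functor_ext => F G a; apply: nat_trans_heq; try exact: e.
by move=> x; exact: heq_refl.
Qed.

Definition dtry_unit : two_nat_trans tfid T :=
  @TwoNatTrans tfid T (dtry_eta Sym) dtry_eta_natural.

(** Relabelling by [F] changes no path, so one decomposition serves both sides. *)
Lemma mu_ob_natural (C D : category) (F : functor C D) (X : T (T C)) :
  mu_ob (dtry_fob (dtry_functor Sym F) X) = dtry_fob F (mu_ob X).
Proof.
apply: dtry_ob_eq => // r r' e; have [p [q e']] := mu_cases r'.
rewrite e' in e.
have -> := @mu_leaf _ _ (dtry_fob (dtry_functor Sym F) X) r p q e.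
by rewrite /= -(mu_leaf e').
Qed.

Lemma dtry_mu_natural (C D : category) :
  postwhisker (T (T C)) (dtry_mu Sym D) ∘F @tfun (tcomp T T) C D =
  prewhisker (T D) (dtry_mu Sym C) ∘F @tfun T C D.
Proof.
have eF (F : functor C D) :
    dtry_mu Sym D ∘F dtry_functor Sym (dtry_functor Sym F) =
    dtry_functor Sym F ∘F dtry_mu Sym C.
  apply: functor_ext => X Y f; apply: dtry_hom_heq; try exact: mu_ob_natural.
  move=> r r' e; have [p [q e']] := mu_cases r'; rewrite e' in e.
  have [f0 f1] := mu_mapE f e'.
  have [g0 g1] := @mu_mapE Sym D _ _
    (dtry_fmap (dtry_functor Sym F) f) r p q e.
  split; first by rewrite g0; exact: esym f0.
  by apply: heq_trans g1 _; apply: heq_sym; apply: heq_fmap f1.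
apply: functor_ext => F G a; apply: nat_trans_heq; try exact: eF.
move=> X; apply: dtry_hom_heq; try exact: mu_ob_natural.
move=> r r' e; have [p [q e']] := mu_cases r'; rewrite e' in e.
(* The twice lifted [a] fixes all paths; only its component at the common leaf remains to be
   compared. *)
have [g0 g1] := @mu_mapE Sym D _ _ (dtry_ncomp (dtry_nat Sym a) X) r p q e.
split; first by rewrite g0 /= e'.
by apply: heq_trans g1 _; apply: heq_ncomp; rewrite (mu_leaf e').
Qed.

Definition dtry_mult : two_nat_trans (tcomp T T) T :=
  @TwoNatTrans (tcomp T T) T (dtry_mu Sym) dtry_mu_natural.

(** * Associativity and unit laws *)

Section Laws.
Variable C : category.

(** The bracketing [(p ++ q) ++ t]. The trees at [s] and at [q] are equal only propositionally, so
    the last segment appears twice, as [t'] and as [t]. *)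
Lemma mu_assoc_cases (X : T (T (T C))) (r : shape (mu_ob (mu_ob X))) :
  exists (p : shape X) (q : shape (leaf p)) (s : shape (mu_ob X))
    (t : shape (leaf q)) (t' : shape (leaf s)),
  [/\ val r = val s ++ val t', val s = val p ++ val q, val t' = val t &
      leaf t' = leaf t].
Proof.
have [s [t' e]] := mu_cases r; have [p [q e']] := mu_cases s.
have [t ev el] := dtry_ob_path t' (mu_leaf e').
by exists p, q, s, t, t'.
Qed.

(** The bracketing [p ++ (q ++ t)], with [s] as its inner path. *)
Lemma mu_assoc_join (X : T (T (T C))) (p : shape X) (q : shape (leaf p))
    (t : shape (leaf q)) :
  exists r : shape (mu_ob (dtry_fob (dtry_mu Sym C) X)),
  exists2 s : shape (mu_ob (leaf p)),
    val r = val p ++ val s & val s = val q ++ val t.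
Proof.
pose s : shape (mu_ob (leaf p)) := path_join (path_mk t).
exists (@path_join Sym C (dtry_fob (dtry_mu Sym C) X)
  (@path_mk Sym C (dtry_fob (dtry_mu Sym C) X) p s)).
by exists s.
Qed.

Lemma mu_ob_assoc (X : T (T (T C))) :
  mu_ob (dtry_fob (dtry_mu Sym C) X) = mu_ob (mu_ob X).
Proof.
apply: dtry_ob_eq.
  move=> w; split.
    case/mu_pathsP=> p [s ->].
    have [q [t ->]] := @mu_cases Sym C (@leaf Sym _ X p) s.
    pose r := path_join (path_mk q).
    have e : leaf (r : shape (mu_ob X)) = leaf q by exact: mu_leaf.
    (* The tree at [r] equals the tree at [q], so [t] has a counterpart there with the same word. *)
    have [t' -> _] := dtry_ob_path t (esym e).
    by apply/mu_pathsP; exists r, t'; rewrite catA.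
  move=> dw; pose r : shape (mu_ob (mu_ob X)) := exist _ w (mem_set dw).
  have [p [q [s [t [t' [e e' ev _]]]]]] := mu_assoc_cases r.
  have [r' [s' er es]] := mu_assoc_join t.
  rewrite -[w]/(val r) e e' ev -catA -es -er; exact: set_valP.
move=> r r' err'.
have [p [q [s [t [t' [e e' ev el]]]]]] := mu_assoc_cases r'.
have [_ [s' _ es]] := mu_assoc_join t.
rewrite (mu_leaf e) el -(mu_leaf es).
apply: (@mu_leaf Sym C (dtry_fob (dtry_mu Sym C) X) r p s').
by rewrite err' e e' ev es catA.
Qed.

Lemma dtry_assoc :
  dtry_mult C ∘F tfun T (dtry_mult C) = dtry_mult C ∘F dtry_mult (T C).
Proof.
apply: functor_ext => X Y f; apply: dtry_hom_heq; try exact: mu_ob_assoc.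
move=> r r' err'.
have [p [q [s [t [t' [e e' ev el]]]]]] := mu_assoc_cases r'.
have [_ [s' _ es]] := mu_assoc_join t.
have er : val r = val p ++ val s' by rewrite err' e e' ev es catA.
(* [a] and [b] evaluate the left side along [p ++ (q ++ t)], [c] and [d] the right side along
   [(p ++ q) ++ t]. *)
have [a0 a1] := @mu_mapE Sym C _ _ (dtry_fmap (dtry_mu Sym C) f) r p s' er.
have [b0 b1] := mu_mapE (leaf_map f p) es.
have [c0 c1] := mu_mapE (mu_map f) e.
have [d0 d1] := mu_mapE f e'.
(* [d1] equates the tree maps at [s] and at [q]; here they are evaluated at the matching paths [t']
   and [t]. *)
have [g0 g1] := heq_dtry_hom d1 ev.
split.
  by apply/esym/(etrans c0); rewrite d0 g0 -catA -b0; exact: esym a0.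
apply: heq_trans a1 _; apply: heq_trans b1 _.
by apply: heq_sym; apply: heq_trans c1 g1.
Qed.

Lemma mu_ob_unitl (X : T C) : mu_ob (dtry_eta_ob Sym X) = X.
Proof.
apply: dtry_ob_eq.
  move=> w; split.
    case/mu_pathsP=> p [q ->]; rewrite (val_root p); exact: (set_valP q).
  move=> dw; apply/mu_pathsP; exists (root_path Sym X).
  by exists (exist _ w (mem_set dw)).
(* [[::] ++ val q] reduces to [val q], so [e] already is a decomposition. *)
by move=> r q e; apply: (@mu_leaf _ _ (dtry_eta_ob Sym X) r (root_path Sym X) q).
Qed.

Lemma dtry_unitl : dtry_mult C ∘F dtry_unit (T C) = fid (T C).
Proof.
apply: functor_ext => X Y f; apply: dtry_hom_heq; try exact: mu_ob_unitl.
move=> r q e.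
exact: (@mu_mapE Sym C _ _ (dtry_eta_map Sym f) r (root_path Sym X) q e).
Qed.

Lemma mu_ob_unitr (X : T C) : mu_ob (dtry_fob (dtry_eta Sym C) X) = X.
Proof.
apply: dtry_ob_eq.
  move=> w; split.
    case/mu_pathsP=> p [q ->].
    rewrite (@val_root Sym C (@leaf Sym C X p) q) cats0; exact: (set_valP p).
  move=> dw; apply/mu_pathsP; exists (exist _ w (mem_set dw)).
  exists (root_path Sym (leaf (exist _ w (mem_set dw) : shape X))).
  by rewrite cats0.
move=> r p e.
apply: (@mu_leaf Sym C (dtry_fob (dtry_eta Sym C) X) r p
  (root_path Sym (leaf p))).
by rewrite e cats0.
Qed.

Lemma dtry_unitr : dtry_mult C ∘F tfun T (dtry_unit C) = fid (T C).
Proof.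
apply: functor_ext => X Y f; apply: dtry_hom_heq; try exact: mu_ob_unitr.
(* [val p ++ [::]] does not reduce, so [e] is first rewritten into a decomposition with the root as
   inner path. *)
move=> r p e; rewrite -[val p]cats0 in e.
have [e0 e1] := @mu_mapE Sym C _ _ (dtry_fmap (dtry_eta Sym C) f) r p
  (root_path Sym (leaf p)) e.
by split=> //; rewrite e0 /= cats0.
Qed.

End Laws.

Definition dtry_monad : two_monad :=
  @TwoMonad T dtry_unit dtry_mult dtry_assoc dtry_unitl dtry_unitr.

End Monad.

Theorem theoremC9 (Sym : Type) (hSym : exists a b : Sym, a <> b) :
  exists T : two_monad, forall C : category, T C = dtry_cat Sym C.
Proof. by exists (dtry_monad Sym). Qed.
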